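(* Let $A\subseteq R$ be an extension of additively idempotent semirings such that $R$ is cancellatively generated, $\sqrt{\Delta_R}$ is cancellative, and for every $x\in R$ the downward-closed $A$-module generated by $x$ is finite (finitely generated) as an $A$-module. Then $$\overline{A}^{\mathrm{J}}=\overline{A}^{\mathrm{D}}=\overline{A}^{\mathrm{Q}}=\overline{A}^{\mathrm{V}}.$$
   Context: Semirings are commutative, with $0$ and $1$, satisfy $a\cdot 0=0$, and are additively idempotent ($a+a=a$); the order is $a\le b\iff a+b=b$. An element $s\neq 0$ of a semiring is cancellative if $sb=sc$ implies $b=c$; a semiring is cancellative if all its nonzero elements are cancellative, and it is cancellatively generated if it is additively generated by its cancellative elements. $A$ is a sub-semiring of $R$. The downward-closed $A$-module generated by $x\in R$ is $\{y\in R: y\le ax\text{ for some }a\in A\}$. A congruence is an equivalence relation compatible with $+$ and $\cdot$. A congruence $\mathcal{C}$ on $R$ is called cancellative if $R/\mathcal{C}$ is a cancellative semiring. A proper congruence $P$ on $R$ is prime if $R/P$ is totally ordered and cancellative. $\Delta_R\subseteq R\times R$ is the trivial (diagonal) congruence, and $\sqrt{\Delta_R}$ is the intersection of all prime congruences on $R$. An element $x\in R$ is J-integral over $A$ if $x^n\le\sum_{i=0}^{n-1}a_ix^i$ for some positive integer $n$ and $a_i\in A$; it is D-integral over $A$ if $x\le y$ for some $y\in R$ that is J-integral over $A$. Let $A\langle x\rangle$ be the smallest downward-closed sub-semiring of $R$ containing $A$ and $x$ (a subset $I$ is downward-closed if $x\le y\in I$ implies $x\in I$). $x$ is quasi-integral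 over $A$ if there is an $A\langle x\rangle$-submodule $M\subseteq R$ that is finite as a downward-closed $A$-module (i.e. $M$ is the downward closure in $R$ of a finitely generated $A$-submodule $L\subseteq M$) and that is faithful as an $A\langle x\rangle$-module (if $a,b\in A\langle x\rangle$ satisfy $am=bm$ for all $m\in M$, then $a=b$). $\overline{A}^{\mathrm{J}},\overline{A}^{\mathrm{D}},\overline{A}^{\mathrm{Q}}$ denote the sets of J-integral, D-integral, quasi-integral elements of $R$ over $A$. For a prime congruence $P$ on $R$, $\kappa(P)$ is the total semiring of fractions of $R/P$ (a semifield), $|x|_P$ is the image of $x$ in $\kappa(P)$, and $R_P=\{x\in R: |x|_P\le 1_{\kappa(P)}\}$. $\overline{A}^{\mathrm{V}}$ is the intersection of all $R_P$ over prime congruences $P$ on $R$ with $A\subseteq R_P$. *)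

(* Defs.v *)
From HB Require Import structures.
From mathcomp Require Import all_boot all_algebra.
From mathcomp Require Import boolp classical_sets.

Set Implicit Arguments.
Unset Strict Implicit.
Unset Printing Implicit Defensive.

Import GRing.Theory.
Local Open Scope classical_set_scope.
Local Open Scope quotient_scope.
Local Open Scope ring_scope.

(* The order a <= b of an additively idempotent semiring. *)
Definition sle (R : nmodType) (a b : R) : Prop := a + b = b.

Notation "a '<=+' b" := (sle a b) (at level 70, no associativity) : ring_scope.

Section Semirings.
Variable S : comPzSemiRingType.

Definition cancellative (s : S) : Prop := s <> 0 /\ GRing.lreg s.

Definition cancellative_semiring : Prop :=
  forall s : S, s <> 0 -> cancellative s.

Definition cancellatively_generated : Prop :=
  forall x : S, exists s : seq S,
    (forall y, y \in s -> cancellative y) /\ x = \sum_(y <- s) y.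

Definition totally_ordered : Prop := forall a b : S, a <=+ b \/ b <=+ a.

End Semirings.

Arguments cancellative_semiring S : clear implicits.
Arguments cancellatively_generated S : clear implicits.
Arguments totally_ordered S : clear implicits.

Record congruence (R : comPzSemiRingType) := Congruence {
  cong :> R -> R -> Prop;
  cong_refl : forall x, cong x x;
  cong_sym : forall x y, cong x y -> cong y x;
  cong_trans : forall x y z, cong x y -> cong y z -> cong x z;
  congD : forall x x' y y', cong x x' -> cong y y' -> cong (x + y) (x' + y');
  congM : forall x x' y y', cong x x' -> cong y y' -> cong (x * y) (x' * y')
}.

Section Quotient.
Variables (R : comPzSemiRingType) (C : congruence R).

Definition congb : rel R := fun x y => `[< C x y >].

Lemma congb_refl : reflexive congb.
Proof. by move=> x; apply/asboolP/cong_refl. Qed.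

Lemma congb_sym : symmetric congb.
Proof. by move=> x y; apply/asboolP/asboolP => /cong_sym. Qed.

Lemma congb_trans : transitive congb.
Proof.
by move=> y x z /asboolP xy /asboolP /(cong_trans xy) ?; apply/asboolP.
Qed.

Definition congb_equiv := EquivRel congb congb_refl congb_sym congb_trans.

Definition quot : Type := {eq_quot congb_equiv}.

HB.instance Definition _ := Choice.on quot.
HB.instance Definition _ : EqQuotient R congb_equiv quot := EqQuotient.on quot.

Definition toquot (x : R) : quot := \pi x.

Lemma toquotP x y : toquot x = toquot y <-> C x y.
Proof.
by split=> [/eqmodP/asboolP|xy] //; apply/eqmodP/asboolP.
Qed.

Lemma toquot_surj (a : quot) : exists x, a = toquot x.
Proof. by exists (repr a); rewrite /toquot reprK. Qed.

Lemma repr_toquot x : C (repr (toquot x)) x.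
Proof. by apply/toquotP; rewrite /toquot reprK. Qed.

Definition quot_add (a b : quot) : quot := toquot (repr a + repr b).
Definition quot_mul (a b : quot) : quot := toquot (repr a * repr b).

Lemma quot_addE x y : quot_add (toquot x) (toquot y) = toquot (x + y).
Proof. by apply/toquotP/congD; apply: repr_toquot. Qed.

Lemma quot_mulE x y : quot_mul (toquot x) (toquot y) = toquot (x * y).
Proof. by apply/toquotP/congM; apply: repr_toquot. Qed.

Fact quot_addA : associative quot_add.
Proof.
move=> a b c; have [[x ->] [[y ->] [z ->]]] :=
  (toquot_surj a, (toquot_surj b, toquot_surj c)).
by rewrite !quot_addE addrA.
Qed.

Fact quot_addC : commutative quot_add.
Proof.
move=> a b; have [[x ->] [y ->]] := (toquot_surj a, toquot_surj b).
by rewrite !quot_addE addrC.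
Qed.

Fact quot_add0 : left_id (toquot 0) quot_add.
Proof. by move=> a; have [x ->] := toquot_surj a; rewrite quot_addE add0r. Qed.

HB.instance Definition _ :=
  GRing.isNmodule.Build quot quot_addA quot_addC quot_add0.

Fact quot_mulA : associative quot_mul.
Proof.
move=> a b c; have [[x ->] [[y ->] [z ->]]] :=
  (toquot_surj a, (toquot_surj b, toquot_surj c)).
by rewrite !quot_mulE mulrA.
Qed.

Fact quot_mulC : commutative quot_mul.
Proof.
move=> a b; have [[x ->] [y ->]] := (toquot_surj a, toquot_surj b).
by rewrite !quot_mulE mulrC.
Qed.

Fact quot_mul1 : left_id (toquot 1) quot_mul.
Proof. by move=> a; have [x ->] := toquot_surj a; rewrite quot_mulE mul1r. Qed.

Fact quot_mulDl : left_distributive quot_mul quot_add.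
Proof.
move=> a b c; have [[x ->] [[y ->] [z ->]]] :=
  (toquot_surj a, (toquot_surj b, toquot_surj c)).
by rewrite !(quot_addE, quot_mulE) mulrDl.
Qed.

Fact quot_mul0 : left_zero (toquot 0) quot_mul.
Proof. by move=> a; have [x ->] := toquot_surj a; rewrite quot_mulE mul0r. Qed.

HB.instance Definition _ := GRing.Nmodule_isComPzSemiRing.Build quot
  quot_mulA quot_mulC quot_mul1 quot_mulDl quot_mul0.

Fact toquot_is_nmod_morphism : nmod_morphism toquot.
Proof. by split=> // x y; rewrite -quot_addE. Qed.

Fact toquot_is_monoid_morphism : monoid_morphism toquot.
Proof. by split=> // x y; rewrite -quot_mulE. Qed.

HB.instance Definition _ :=
  GRing.isNmodMorphism.Build R quot toquot toquot_is_nmod_morphism.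
HB.instance Definition _ :=
  GRing.isMonoidMorphism.Build R quot toquot toquot_is_monoid_morphism.

End Quotient.

(* The total semiring of fractions of S: the localization of S at all its
   cancellative elements. A denominator is required to be regular but not to be
   nonzero; this makes a difference only if S is the zero semiring, whose total
   semiring of fractions is then the zero semiring. As denominators are regular,
   a / s = b / t reduces to a t = b s. *)
Section Fractions.
Variable S : comPzSemiRingType.

Record tratio := TRatio { tnum : S; tden : S; tden_reg : GRing.lreg tden }.

HB.instance Definition _ := gen_eqMixin tratio.
HB.instance Definition _ := gen_choiceMixin tratio.

Definition eqtratio : rel tratio :=
  fun u v => tnum u * tden v == tnum v * tden u.

Lemma eqtratio_refl : reflexive eqtratio.
Proof. by move=> u; apply/eqP. Qed.

Lemma eqtratio_sym : symmetric eqtratio.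
Proof. by move=> u v; rewrite /eqtratio eq_sym. Qed.

Lemma eqtratio_trans : transitive eqtratio.
Proof.
move=> v u w /eqP uv /eqP vw; apply/eqP/(@tden_reg v).
rewrite [LHS](AC (1*2) (2*1*3))/= uv [LHS]mulrAC vw.
by rewrite [LHS](AC (2*1) (2*(1*3))).
Qed.

Definition eqtratio_equiv :=
  EquivRel eqtratio eqtratio_refl eqtratio_sym eqtratio_trans.

Definition tfrac : Type := {eq_quot eqtratio_equiv}.

HB.instance Definition _ := Choice.on tfrac.
HB.instance Definition _ : EqQuotient tratio eqtratio_equiv tfrac :=
  EqQuotient.on tfrac.

Definition tratio_class (u : tratio) : tfrac := \pi u.

Lemma tratio_classP u v :
  tratio_class u = tratio_class v <-> tnum u * tden v = tnum v * tden u.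
Proof. by split=> [/eqmodP/eqP|uv] //; apply/eqmodP/eqP. Qed.

Lemma tratio_class_surj (a : tfrac) : exists u, a = tratio_class u.
Proof. by exists (repr a); rewrite /tratio_class reprK. Qed.

Lemma repr_tratio_class u :
  tnum (repr (tratio_class u)) * tden u = tnum u * tden (repr (tratio_class u)).
Proof. by apply/tratio_classP; rewrite /tratio_class reprK. Qed.

Definition tratio_of (x : S) : tratio := TRatio x (@lreg1 S).
Definition tratio_add (u v : tratio) : tratio :=
  TRatio (tnum u * tden v + tnum v * tden u)
    (lregM (@tden_reg u) (@tden_reg v)).
Definition tratio_mul (u v : tratio) : tratio :=
  TRatio (tnum u * tnum v) (lregM (@tden_reg u) (@tden_reg v)).

Definition totfrac (x : S) : tfrac := tratio_class (tratio_of x).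
Definition tfrac_add (a b : tfrac) : tfrac :=
  tratio_class (tratio_add (repr a) (repr b)).
Definition tfrac_mul (a b : tfrac) : tfrac :=
  tratio_class (tratio_mul (repr a) (repr b)).

Lemma tfrac_addE u v :
  tfrac_add (tratio_class u) (tratio_class v) = tratio_class (tratio_add u v).
Proof.
apply/tratio_classP => /=.
have Eu := repr_tratio_class u; have Ev := repr_tratio_class v.
set u' := repr _ in Eu *; set v' := repr _ in Ev *.
rewrite !mulrDl; congr (_ + _).
  by rewrite mulrACA Eu [_ * tden v]mulrC mulrACA.
by rewrite [LHS](AC (2*2) (1*4*(2*3))) /= Ev [LHS](AC (2*2) (1*4*(3*2))).
Qed.

Lemma tfrac_mulE u v :
  tfrac_mul (tratio_class u) (tratio_class v) = tratio_class (tratio_mul u v).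
Proof.
by apply/tratio_classP; rewrite /= mulrACA !repr_tratio_class mulrACA.
Qed.

Fact tfrac_addA : associative tfrac_add.
Proof.
move=> a b c; have [[u ->] [[v ->] [w ->]]] :=
  (tratio_class_surj a, (tratio_class_surj b, tratio_class_surj c)).
rewrite !tfrac_addE; apply/tratio_classP; rewrite /= !mulrDl !mulrA addrA.
by rewrite [tnum v * _ * _]mulrAC [tnum w * tden u * _]mulrAC
  [tnum w * tden v * _]mulrAC.
Qed.

Fact tfrac_addC : commutative tfrac_add.
Proof.
move=> a b; have [[u ->] [v ->]] := (tratio_class_surj a, tratio_class_surj b).
by rewrite !tfrac_addE; apply/tratio_classP; rewrite /= addrC [tden u * _]mulrC.
Qed.

Fact tfrac_add0 : left_id (totfrac 0) tfrac_add.
Proof.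
move=> a; have [u ->] := tratio_class_surj a.
by rewrite tfrac_addE; apply/tratio_classP; rewrite /= mul0r add0r mulr1 mul1r.
Qed.

HB.instance Definition _ :=
  GRing.isNmodule.Build tfrac tfrac_addA tfrac_addC tfrac_add0.

Fact tfrac_mulA : associative tfrac_mul.
Proof.
move=> a b c; have [[u ->] [[v ->] [w ->]]] :=
  (tratio_class_surj a, (tratio_class_surj b, tratio_class_surj c)).
by rewrite !tfrac_mulE; apply/tratio_classP; rewrite /= !mulrA.
Qed.

Fact tfrac_mulC : commutative tfrac_mul.
Proof.
move=> a b; have [[u ->] [v ->]] := (tratio_class_surj a, tratio_class_surj b).
rewrite !tfrac_mulE; apply/tratio_classP => /=.
by rewrite [tnum u * _]mulrC [tden u * _]mulrC.
Qed.

Fact tfrac_mul1 : left_id (totfrac 1) tfrac_mul.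
Proof.
move=> a; have [u ->] := tratio_class_surj a.
by rewrite tfrac_mulE; apply/tratio_classP; rewrite /= !mul1r.
Qed.

Fact tfrac_mulDl : left_distributive tfrac_mul tfrac_add.
Proof.
move=> a b c; have [[u ->] [[v ->] [w ->]]] :=
  (tratio_class_surj a, (tratio_class_surj b, tratio_class_surj c)).
rewrite !(tfrac_addE, tfrac_mulE); apply/tratio_classP => /=.
rewrite [tnum u * _ * (tden v * _)]mulrACA [tnum v * _ * (tden u * _)]mulrACA.
by rewrite -mulrDl [LHS](AC (2*(2*2)) (1*(2*4)*(3*5*6))).
Qed.

Fact tfrac_mul0 : left_zero (totfrac 0) tfrac_mul.
Proof.
move=> a; have [u ->] := tratio_class_surj a.
by rewrite tfrac_mulE; apply/tratio_classP; rewrite /= !mul0r.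
Qed.

HB.instance Definition _ := GRing.Nmodule_isComPzSemiRing.Build tfrac
  tfrac_mulA tfrac_mulC tfrac_mul1 tfrac_mulDl tfrac_mul0.

Fact totfrac_is_nmod_morphism : nmod_morphism totfrac.
Proof.
split=> // x y; apply: (etrans _ (esym (tfrac_addE _ _))).
by apply/tratio_classP; rewrite /= !mulr1.
Qed.

Fact totfrac_is_monoid_morphism : monoid_morphism totfrac.
Proof.
split=> // x y; apply: (etrans _ (esym (tfrac_mulE _ _))).
by apply/tratio_classP; rewrite /= !mulr1.
Qed.

HB.instance Definition _ :=
  GRing.isNmodMorphism.Build S tfrac totfrac totfrac_is_nmod_morphism.
HB.instance Definition _ :=
  GRing.isMonoidMorphism.Build S tfrac totfrac totfrac_is_monoid_morphism.

Lemma totfrac_inj : injective totfrac.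
Proof. by move=> x y /tratio_classP; rewrite /= !mulr1. Qed.

End Fractions.

Section PrimeCongruences.
Variable R : comPzSemiRingType.

Definition cancellative_congruence (C : congruence R) : Prop :=
  cancellative_semiring (quot C).

Definition proper_congruence (C : congruence R) : Prop :=
  exists x y, ~ C x y.

Definition prime_congruence (P : congruence R) : Prop :=
  [/\ proper_congruence P, totally_ordered (quot P)
    & cancellative_congruence P].

Definition sqrtDelta_rel (x y : R) : Prop :=
  forall P, prime_congruence P -> P x y.

Fact sqrtDelta_refl x : sqrtDelta_rel x x.
Proof. by move=> P _; apply: cong_refl. Qed.

Fact sqrtDelta_sym x y : sqrtDelta_rel x y -> sqrtDelta_rel y x.
Proof. by move=> xy P /xy /cong_sym. Qed.

Fact sqrtDelta_trans x y z :
  sqrtDelta_rel x y -> sqrtDelta_rel y z -> sqrtDelta_rel x z.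
Proof. by move=> xy yz P pP; apply: cong_trans (xy P pP) (yz P pP). Qed.

Fact sqrtDeltaD x x' y y' : sqrtDelta_rel x x' -> sqrtDelta_rel y y' ->
  sqrtDelta_rel (x + y) (x' + y').
Proof. by move=> xx yy P pP; apply: congD (xx P pP) (yy P pP). Qed.

Fact sqrtDeltaM x x' y y' : sqrtDelta_rel x x' -> sqrtDelta_rel y y' ->
  sqrtDelta_rel (x * y) (x' * y').
Proof. by move=> xx yy P pP; apply: congM (xx P pP) (yy P pP). Qed.

Definition sqrtDelta : congruence R := Congruence
  sqrtDelta_refl sqrtDelta_sym sqrtDelta_trans sqrtDeltaD sqrtDeltaM.

Definition kappa (P : congruence R) : comPzSemiRingType := tfrac (quot P).

Definition absv (P : congruence R) (x : R) : kappa P := totfrac (toquot P x).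

Definition val_semiring (P : congruence R) : set R :=
  [set x | absv P x <=+ 1].

End PrimeCongruences.

Arguments sqrtDelta R : clear implicits.

Section Modules.
Variable R : comPzSemiRingType.
Implicit Types A B L M : set R.

Definition subsemiring A : Prop := GRing.semiring_closed [in A].

Definition submodule A M : Prop :=
  GRing.nmod_closed [in M] /\ forall a m, A a -> M m -> M (a * m).

Definition lin_span A n (g : 'I_n -> R) : set R :=
  [set y | exists a : 'I_n -> R,
     (forall i, A (a i)) /\ y = \sum_(i < n) a i * g i].

Definition finite_module A M : Prop :=
  exists n (g : 'I_n -> R), M = lin_span A g.

Definition down_closed B : Prop := forall x y, x <=+ y -> B y -> B x.

Definition down_closure B : set R := [set x | exists2 y, B y & x <=+ y].

Definition down_module_gen A (x : R) : set R :=
  [set y | exists2 a, A a & y <=+ a * x].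

Definition down_semiring_gen A (x : R) : set R :=
  smallest [set B | subsemiring B /\ down_closed B] (A `|` [set x]).

Definition finite_down_module A M : Prop :=
  exists L, [/\ L `<=` M, submodule A L, finite_module A L
              & M = down_closure L].

Definition faithful_module B M : Prop :=
  forall a b, B a -> B b -> (forall m, M m -> a * m = b * m) -> a = b.

Definition J_integral A (x : R) : Prop :=
  exists n (a : 'I_n -> R),
    [/\ (0 < n)%N, forall i, A (a i) & x ^+ n <=+ \sum_(i < n) a i * x ^+ i].

Definition D_integral A (x : R) : Prop :=
  exists2 y, J_integral A y & x <=+ y.

Definition quasi_integral A (x : R) : Prop :=
  exists M, [/\ submodule (down_semiring_gen A x) M, finite_down_module A M
              & faithful_module (down_semiring_gen A x) M].

Definition J_closure A : set R := [set x | J_integral A x].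
Definition D_closure A : set R := [set x | D_integral A x].
Definition Q_closure A : set R := [set x | quasi_integral A x].

Definition V_closure A : set R :=
  \bigcap_(P in [set P | prime_congruence P /\ A `<=` val_semiring P])
    val_semiring P.

End Modules.

(* Main.v *)
Require Import Defs.
From mathcomp Require Import all_boot all_algebra.
From mathcomp Require Import boolp classical_sets.

(** The four closures are related by the cycle of inclusions
J <= D <= Q <= J <= V <= J.

The pivot is [dominated_J_integral]: [x] is J-integral as soon as some nonzero
[h] and some [a] in [A] satisfy [h * x <=+ a * h]. In that case the downward
closed module generated by [h] is stable under [x], and it is finite by
hypothesis, so [x] acts on its generators by a matrix over [A]. An idempotent
form of the Cayley-Hamilton theorem ([matrix_integrality]) bounds the action of
[x ^+ n] on this module by that of a polynomial in [x] of smaller degree over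
[A]. As [R] is cancellatively generated, the module contains a cancellative
element, which can be cancelled from the resulting inequality.

- D <= Q: the powers of a J-integral [y] above [x] span the required module.
- Q <= J: the sum of the generators of the module serves as [h].
- J <= V: in a totally ordered cancellative semiring where the coefficients are
  at most 1, an element above 1 cannot satisfy an integral inequality.
- V <= J: if [x] is not J-integral, the pivot says that [h * x <=+ a * h] never
  holds with [h] nonzero and [a] in [A]. Thus the preorder for which [y] is below
  [z] when [s * y <=+ a * (s * z)] for some nonzero [s] and some [a] in [A] does
  not put [x] below 1. It is compatible with the operations, nonzero elements
  can be cancelled from it, and it puts [A] below 1. By Zorn's lemma it extends
  to a preorder that is maximal among those which have the first two properties
  and do not put [x] below 1. A maximal one is total ([total_extension]), so it
  is the order of a prime congruence at which [A] has values at most 1 and [x]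
  has not. *)

Local Open Scope ring_scope.

Set Implicit Arguments.
Unset Strict Implicit.
Import GRing.Theory.

(** * The order of an additively idempotent semiring *)

Section Order.
Variable R : comPzSemiRingType.
Implicit Types a b c d e : R.

Lemma sle_trans b a c : a <=+ b -> b <=+ c -> a <=+ c.
Proof. by rewrite /sle => ab <-; rewrite addrA ab. Qed.

Lemma sle_anti a b : a <=+ b -> b <=+ a -> a = b.
Proof. by rewrite /sle => ab <-; rewrite addrC ab. Qed.

Lemma sle0 a : 0 <=+ a. Proof. exact: add0r. Qed.

Lemma sle_eq0 a : a <=+ 0 -> a = 0.
Proof. by move=> /sle_anti; apply; exact: sle0. Qed.

Lemma sle_join a b c : a <=+ c -> b <=+ c -> a + b <=+ c.
Proof. by rewrite /sle => ac bc; rewrite -addrA bc. Qed.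

Lemma sle_mulr c a b : a <=+ b -> a * c <=+ b * c.
Proof. by rewrite /sle => ab; rewrite -mulrDl ab. Qed.

Lemma sle_mull c a b : a <=+ b -> c * a <=+ c * b.
Proof. by rewrite /sle => ab; rewrite -mulrDr ab. Qed.

Lemma sle_mul a b c d : a <=+ b -> c <=+ d -> a * c <=+ b * d.
Proof. by move=> /(@sle_mulr c) ab /(@sle_mull b); apply: sle_trans. Qed.

Lemma sle_sum_join n (F : 'I_n -> R) c :
  (forall i, F i <=+ c) -> \sum_(i < n) F i <=+ c.
Proof.
move=> Fc; apply: (big_ind (fun a => a <=+ c)) => //; first exact: sle0.
by move=> a b; apply: sle_join.
Qed.

Hypothesis addRR : forall a : R, a + a = a.

Lemma sle_refl a : a <=+ a. Proof. exact: addRR. Qed.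

Lemma sle_addr a b : a <=+ a + b. Proof. by rewrite /sle addrA addRR. Qed.

Lemma sle_addl a b : a <=+ b + a. Proof. by rewrite addrC; apply: sle_addr. Qed.

Lemma sle_sum n (F : 'I_n -> R) i : F i <=+ \sum_(j < n) F j.
Proof. by rewrite (bigD1 i) //=; apply: sle_addr. Qed.

Lemma sle_add a b c d : a <=+ b -> c <=+ d -> a + c <=+ b + d.
Proof.
move=> ab cd; apply: sle_join; first exact: sle_trans ab (sle_addr _ _).
exact: sle_trans cd (sle_addl _ _).
Qed.

Lemma sle_exp2r n a b : a <=+ b -> a ^+ n <=+ b ^+ n.
Proof.
move=> ab; elim: n => [|n IH]; first by rewrite !expr0; apply: sle_refl.
by rewrite !exprS; apply: sle_mul.
Qed.

Lemma sle1_exp n e : 1 <=+ e -> 1 <=+ e ^+ n.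
Proof. by move=> /(@sle_exp2r n); rewrite expr1n. Qed.

Lemma sle1_exp2l m n e : 1 <=+ e -> (m <= n)%N -> e ^+ m <=+ e ^+ n.
Proof.
move=> e1 mn; rewrite -(subnK mn) exprD -[X in X <=+ _]mul1r.
by apply: sle_mulr; apply: sle1_exp.
Qed.

Lemma mulrn_idem a n : (0 < n)%N -> a *+ n = a.
Proof.
by case: n => // n _; elim: n => // n IH; rewrite mulrS IH addRR.
Qed.

End Order.

(** * Sub-semirings and their finitely generated modules *)

Section Subsemiring.
Variables (R : comPzSemiRingType) (A : set R).
Hypothesis subA : subsemiring A.

Lemma subsemiring0 : A 0.
Proof. by case: subA => -[/set_mem]. Qed.

Lemma subsemiring1 : A 1.
Proof. by case: subA => _ [/set_mem]. Qed.

Lemma subsemiringD a b : A a -> A b -> A (a + b).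
Proof. by case: subA => -[_ AD] _ Aa Ab; apply/set_mem/AD; apply/mem_set. Qed.

Lemma subsemiringM a b : A a -> A b -> A (a * b).
Proof. by case: subA => _ [_ AM] Aa Ab; apply/set_mem/AM; apply/mem_set. Qed.

Lemma subsemiringX a n : A a -> A (a ^+ n).
Proof.
move=> Aa; elim: n => [|n IH]; first exact: subsemiring1.
by rewrite exprS; apply: subsemiringM.
Qed.

Lemma subsemiring_sum n (F : 'I_n -> R) :
  (forall i, A (F i)) -> A (\sum_(i < n) F i).
Proof.
move=> AF; apply: (big_ind A) => //; first exact: subsemiring0.
exact: subsemiringD.
Qed.

Lemma lin_span_gen n (g : 'I_n -> R) i : lin_span A g (g i).
Proof.
exists (fun j => (j == i)%:R); split.
  by move=> j; case: eqP => _; [apply: subsemiring1 | apply: subsemiring0].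
rewrite (bigD1 i) //= eqxx mul1r big1 ?addr0 // => j /negPf ->.
exact: mul0r.
Qed.

Lemma lin_span_submodule n (g : 'I_n -> R) : submodule A (lin_span A g).
Proof.
split; first split.
- apply/mem_set; exists (fun=> 0); split=> [_|]; first exact: subsemiring0.
  by rewrite big1 // => i _; rewrite mul0r.
- move=> _ _ /set_mem [a [Aa ->]] /set_mem [b [Ab ->]]; apply/mem_set.
  exists (fun i => a i + b i); split=> [i|]; first exact: subsemiringD.
  by rewrite -big_split; apply: eq_bigr => i _; rewrite mulrDl.
- move=> c _ Ac [a [Aa ->]]; exists (fun i => c * a i).
  split=> [i|]; first exact: subsemiringM.
  by rewrite mulr_sumr; apply: eq_bigr => i _; rewrite mulrA.
Qed.

Hypothesis addRR : forall a : R, a + a = a.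

Lemma lin_span_dominated n (g : 'I_n -> R) y :
  lin_span A g y -> exists2 c, A c & y <=+ c * \sum_(i < n) g i.
Proof.
move=> [a [Aa ->]]; exists (\sum_(i < n) a i); first exact: subsemiring_sum.
by apply: sle_sum_join => i; apply: sle_mul; apply: sle_sum.
Qed.

End Subsemiring.

(** * Integrality from a matrix over an idempotent semiring *)

Section MatrixIntegrality.
Variables (R : comPzSemiRingType) (n : nat).
Hypothesis addRR : forall a : R, a + a = a.
Variables (x e : R) (g : 'I_n -> R) (a : 'I_n -> 'I_n -> R).
Hypothesis e1 : 1 <=+ e.
Hypothesis ae : forall i j, a i j <=+ e.
Hypothesis xg : forall i, x * g i = \sum_(j < n) a i j * g j.

(** Expanding [x ^+ n * g i] by [xg] gives a sum over the walks of length [n] from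
[i] in the complete graph on ['I_n]. A term can be bounded as soon as its walk
closes a cycle, which happens within [n] steps by the pigeonhole principle:
cutting the cycle out leaves a shorter walk from [i], and its contribution is
below a smaller power of [x] applied to [g i].

The state of a partial walk is its length [k], its end [j], its weight [w] and
its set [U] of vertices. For each vertex [v] it has visited, it carries a
factorization of the weight at [v]: [al] is the weight of the part of length [t]
from [i] to [v], and [be] that of the part after [v]. *)
Lemma walk_bound i m k (U : {set 'I_n}) j w :
  (m + k)%N = n -> #|U| = k.+1 ->
  w * g j <=+ x ^+ k * g i ->
  (forall v, v \in U -> exists al be t, [/\ w <=+ al * be, be <=+ e ^+ k,
      al * g v <=+ x ^+ t * g i & (t <= k)%N]) ->
  w * (x ^+ m * g j) <=+ \sum_(l < n) e ^+ n * x ^+ l * g i.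
Proof.
elim: m k U j w => [|m IH] k U j w mkn cU wg visited.
  by have := max_card (mem U); rewrite cU card_ord -mkn ltnn.
rewrite exprSr -mulrA xg !mulr_sumr; apply: sle_sum_join => j'.
rewrite [_ * (a j j' * _)]mulrCA mulrA.
have [j'U|j'U] := boolP (j' \in U); last first.
  have wg' : w * a j j' * g j' <=+ x ^+ k.+1 * g i.
    apply: (@sle_trans _ (w * (x * g j))).
      by rewrite -mulrA xg; apply: sle_mull; apply: (sle_sum addRR).
    by rewrite mulrCA exprS -mulrA; apply: sle_mull.
  apply: (IH k.+1 (j' |: U)%SET) => //.
  - by rewrite addnS.
  - by rewrite cardsU1 j'U cU.
  - move=> v; rewrite in_setU1 => /orP [/eqP ->|vU].
      exists (w * a j j'), 1, k.+1; rewrite mulr1; split => //.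
      exact: sle1_exp.
    have [al [be [t [wab bek alg tk]]]] := visited v vU.
    exists al, (be * a j j'), t; split=> //; last exact: leqW.
    + by rewrite mulrA; apply: sle_mulr.
    + by rewrite exprSr; apply: sle_mul.
(* The step to [j'] closes a cycle of weight [be * a j j'] at [j']. Replacing the
   walk by its part up to the first visit of [j'] shortens it by at least 1. *)
have [al [be [t [wab bek alg tk]]]] := visited j' j'U.
have ltn : (m + t < n)%N by rewrite -mkn addSn ltnS leq_add2l.
apply: sle_trans (sle_sum addRR (fun l : 'I_n => e ^+ n * x ^+ l * g i)
  (Ordinal ltn)) => /=.
apply: (@sle_trans _ (al * be * a j j' * (x ^+ m * g j'))).
  by do 2 apply: sle_mulr.
rewrite exprD -[X in _ <=+ X]mulrA -[x ^+ m * x ^+ t * _]mulrA.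
rewrite -[al * be * _]mulrA [al * _]mulrC -[_ * al * _]mulrA (mulrCA al).
apply: sle_mul; last exact/sle_mull.
apply: (@sle_trans _ (e ^+ k.+1)); first by rewrite exprSr; apply: sle_mul.
by apply: sle1_exp2l => //; rewrite -mkn addSn ltnS leq_addl.
Qed.

(** The Cayley-Hamilton theorem expresses the [n]th power of the matrix through
the lower ones, with coefficients that are sums of cycle weights; here these
coefficients are all enlarged to [e ^+ n]. *)
Lemma matrix_integrality i :
  x ^+ n * g i <=+ \sum_(l < n) e ^+ n * x ^+ l * g i.
Proof.
rewrite -[x ^+ n * _]mul1r.
apply: (@walk_bound i n 0 [set i]%SET) => //; rewrite ?addn0 ?cards1 //.
move=> v /set1P ->; exists 1, 1, 0; rewrite mulr1.
by split=> //; apply: (sle_refl addRR).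
Qed.

End MatrixIntegrality.

(** * The integrality criterion *)

Section CancellativelyGenerated.
Variable R : comPzSemiRingType.
Hypothesis addRR : forall a : R, a + a = a.
Hypothesis genR : cancellatively_generated R.

Lemma cancellative_below (h : R) :
  h <> 0 -> exists2 s, cancellative s & s <=+ h.
Proof.
have [[|y s] [canc ->]] := genR h; first by rewrite big_nil.
move=> _; exists y; first by apply: canc; rewrite mem_head.
by rewrite big_cons; apply: sle_addr.
Qed.

Lemma nonzero_mul (s t : R) : s <> 0 -> t <> 0 -> s * t <> 0.
Proof.
move=> /cancellative_below [s' [_ s'reg] s's] t0 st0.
apply/t0/s'reg; rewrite mulr0; apply: sle_eq0.
by rewrite -st0; apply: sle_mulr.
Qed.

Variable A : set R.
Hypothesis subA : subsemiring A.
Hypothesis finA : forall x : R, finite_module A (down_module_gen A x).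

(** The finiteness hypothesis turns the inequality [h * x <=+ a * h] into
equations: the generators of the downward closed module of [h] are mapped by [x]
to exact combinations of themselves. Inequalities would not be enough for
[matrix_integrality], which uses both directions: one to expand a power of [x]
into walks, the other to bound a shortened walk by a power of [x]. *)
Lemma dominated_J_integral (x a h : R) :
  A a -> h <> 0 -> h * x <=+ a * h -> J_integral A x.
Proof.
move=> Aa /cancellative_below [s [s0 sreg] sh] hx.
have [n [g Dg]] := finA h.
have gD i : down_module_gen A h (g i) by rewrite Dg; apply: lin_span_gen.
have xgD i : exists b : 'I_n -> R,
    (forall j, A (b j)) /\ x * g i = \sum_(j < n) b j * g j.
  have: down_module_gen A h (x * g i); last by rewrite Dg.
  have [b Ab gb] := gD i; exists (b * a); first exact: subsemiringM.
  apply: (@sle_trans _ (x * (b * h))); first exact: sle_mull.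
  by rewrite mulrCA -mulrA [x * h]mulrC; apply: sle_mull.
have [b /all_and2 [Ab xg]] := choice xgD.
pose e := 1 + \sum_(i < n) \sum_(j < n) b i j.
have Ae : A e.
  apply: subsemiringD => //; first exact: subsemiring1.
  by do 2 apply: subsemiring_sum => // ?.
have be i j : b i j <=+ e.
  apply: sle_trans (sle_addl addRR _ _).
  apply: sle_trans (sle_sum addRR (fun i => \sum_(j < n) b i j) i).
  exact: (sle_sum addRR).
have e1 : 1 <=+ e by apply: sle_addr.
have CH := matrix_integrality addRR e1 be xg.
have: down_module_gen A h s.
  by exists 1; [apply: subsemiring1 | rewrite mul1r].
rewrite Dg => -[c [_ sE]].
(* The module contains [s], which is nonzero, so it has a generator. *)
have n0 : (0 < n)%N by case: n g c sE {Dg gD xgD b Ab xg e Ae be e1 CH} => // g c;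
  rewrite big_ord0.
exists n, (fun=> e ^+ n); split=> // [i|]; first exact: subsemiringX.
apply: sreg; rewrite mulrDr -/(sle _ _) ![s * _]mulrC sE !mulr_sumr.
apply: sle_sum_join => i.
apply: sle_trans (sle_sum addRR _ i); rewrite !(mulrCA _ (c i)).
apply: sle_mull; apply: sle_trans (CH i) _; rewrite mulr_suml.
exact: (sle_refl addRR).
Qed.

End CancellativelyGenerated.

(** * J-integral, D-integral and quasi-integral elements *)

Section Closures.
Variables (R : comPzSemiRingType) (A : set R).
Hypothesis addRR : forall a : R, a + a = a.
Hypothesis subA : subsemiring A.

Lemma J_sub_D : (J_closure A `<=` D_closure A)%classic.
Proof. by move=> x Jx; exists x => //; apply: (sle_refl addRR). Qed.

Lemma down_closure_submodule (L : set R) :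
  submodule A L -> submodule A (down_closure L).
Proof.
move=> [[L0 LD] LM]; split; first split.
- by apply/mem_set; exists 0; [apply: set_mem | apply: sle0].
- move=> y z /set_mem [u Lu yu] /set_mem [v Lv zv]; apply/mem_set.
  exists (u + v); last exact: sle_add.
  by apply/set_mem/LD; apply/mem_set.
- by move=> a y Aa [u Lu yu]; exists (a * u); [apply: LM | apply: sle_mull].
Qed.

(** A larger scalar sends a member of a downward closed module to a larger
member, so the multipliers of such a module form a downward closed
sub-semiring. *)
Lemma down_semiring_gen_submodule (M : set R) x :
  submodule A M -> down_closed M -> (forall m, M m -> M (x * m)) ->
  submodule (down_semiring_gen A x) M.
Proof.
move=> [[M0 MD] AM] dM xM; split=> // b m Bb; move: m.
have {}MD y z : M y -> M z -> M (y + z).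
  by move=> My Mz; apply/set_mem/MD; apply/mem_set.
pose B : set R := fun c => forall m, M m -> M (c * m).
apply: (@smallest_sub _ _ _ B _ _ b Bb).
  split; first split; first split.
  - by apply/mem_set => m _; rewrite mul0r; apply: set_mem.
  - move=> c d /set_mem Bc /set_mem Bd; apply/mem_set => m Mm.
    by rewrite mulrDl; apply: MD; [apply: Bc | apply: Bd].
  - split; first by apply/mem_set => m; rewrite mul1r.
    move=> c d /set_mem Bc /set_mem Bd; apply/mem_set => m Mm.
    by rewrite -mulrA; apply/Bc/Bd.
  - by move=> c d cd Bd m Mm; apply: dM (Bd m Mm); apply: sle_mulr.
by move=> c [Ac|->] m Mm; [apply: AM | apply: xM].
Qed.

(** When [y ^+ n <=+ \sum_(i < n) a i * y ^+ i], multiplication by [y] preserves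
the downward closure of the module spanned by [1, y, ..., y ^+ n.-1], hence so
does multiplication by anything below [y]; this module contains 1, so it is
faithful. *)
Lemma D_sub_Q : (D_closure A `<=` Q_closure A)%classic.
Proof.
move=> x [y [n [a [n0 Aa yn]]] xy].
pose g (i : 'I_n) := y ^+ i; pose L := lin_span A g.
have subL : submodule A L by apply: lin_span_submodule.
have [[M0 MD] AM] := down_closure_submodule subL.
have LM : (L `<=` down_closure L)%classic.
  by move=> z Lz; exists z => //; apply: (sle_refl addRR).
have dM : down_closed (down_closure L).
  by move=> u v uv [w Lw vw]; exists w => //; apply: sle_trans uv vw.
have Mpow i : (i < n)%N -> L (y ^+ i).
  by move=> ltin; apply: (lin_span_gen subA g (Ordinal ltin)).
have yM m : down_closure L m -> down_closure L (y * m).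
  move=> [_ [c [Ac ->]] mc]; apply: dM (sle_mull y mc) _.
  rewrite mulr_sumr; apply: (big_ind (down_closure L)).
  - exact: set_mem.
  - by move=> u v Mu Mv; apply/set_mem/MD; apply/mem_set.
  - move=> i _; rewrite mulrCA -exprS; apply: AM => //.
    have [ltin|] := ltnP i.+1 n; first exact/LM/Mpow.
    move=> nlei; have -> : i.+1 = n by apply/eqP; rewrite eqn_leq nlei ltn_ord.
    by exists (\sum_(i < n) a i * y ^+ i) => //; exists a.
exists (down_closure L); split.
- apply: down_semiring_gen_submodule => // m Mm.
  by apply: dM (sle_mulr m xy) _; apply: yM.
- by exists L; split=> //; exists n, g.
- move=> b c _ _ bc; rewrite -[b]mulr1 -[c]mulr1; apply: bc.
  by rewrite -(expr0 y); apply/LM/Mpow.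
Qed.

Lemma trivial_J_integral (x : R) : 1 = 0 :> R -> J_integral A x.
Proof.
move=> E; exists 1%N, (fun=> 0); split=> // [_|]; first exact: subsemiring0.
by rewrite -[x ^+ 1]mul1r E mul0r; apply: sle0.
Qed.

Hypothesis genR : cancellatively_generated R.
Hypothesis finA : forall x : R, finite_module A (down_module_gen A x).

(** The sum [G] of the generators of [M] dominates [M] up to a factor in [A], so
[x * G], which lies in [M], is below a multiple of [G]. *)
Lemma Q_sub_J : (Q_closure A `<=` J_closure A)%classic.
Proof.
move=> x [M [[_ xM] [L [LM [[L0 LD] _] [n [g Lg]] ME]] faithM]].
rewrite {}ME {M} in xM LM faithM.
pose G := \sum_(i < n) g i.
have Ldom y : L y -> exists2 c, A c & y <=+ c * G.
  by rewrite Lg; apply: lin_span_dominated.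
have [G0|G0] := pselect (G = 0).
  (* Then [M] is zero, and its faithfulness forces 1 = 0. *)
  have bot y : A y -> down_semiring_gen A x y.
    by move=> Ay; apply: sub_gen_smallest; left.
  apply: trivial_J_integral; apply: faithM.
  - by apply: bot; apply: subsemiring1.
  - by apply: bot; apply: subsemiring0.
  - move=> m [y /Ldom [c _ yc] my]; suff -> : m = 0 by rewrite !mulr0.
    by apply: sle_eq0; apply: sle_trans my _; rewrite G0 mulr0 in yc.
have LG : L G.
  apply: (big_ind L); first exact: set_mem.
    by move=> u v Lu Lv; apply/set_mem/LD; apply/mem_set.
  by move=> i _; rewrite Lg; apply: lin_span_gen.
have [y Ly xGy] : down_closure L (x * G).
  apply: xM; first by apply: sub_gen_smallest; right.
  by exists G => //; apply: (sle_refl addRR).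
have [c Ac yc] := Ldom _ Ly.
apply: (dominated_J_integral addRR genR subA finA Ac G0).
by rewrite mulrC; apply: sle_trans xGy yc.
Qed.

End Closures.

(** * Prime congruences as total preorders *)

(** The relation [C (y + z) z] attached to a congruence [C] is such a preorder when
[C] is proper and cancellative and [C y 0] only holds at [y = 0]; every such
preorder with [~ le 1 0] arises in this way. It is easier to enlarge a preorder
than a congruence. *)
Record cancellative_preorder (R : comPzSemiRingType) (le : R -> R -> Prop) :
    Prop := CancellativePreorder {
  preorder_sle : forall y z, y <=+ z -> le y z;
  preorder_trans : forall z y w, le y z -> le z w -> le y w;
  preorder_join : forall y z w, le y w -> le z w -> le (y + z) w;
  preorder_mul : forall w y z, le y z -> le (y * w) (z * w);
  preorder_cancel : forall s y z, s <> 0 -> le (y * s) (z * s) -> le y z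
}.

Section PreorderCongruence.
Variable R : comPzSemiRingType.
Hypothesis addRR : forall a : R, a + a = a.
Variable le : R -> R -> Prop.
Hypothesis leP : cancellative_preorder le.

Lemma preorder_refl y : le y y.
Proof. by apply: (preorder_sle leP); apply: sle_refl. Qed.

Lemma preorder_add y y' z z' : le y y' -> le z z' -> le (y + z) (y' + z').
Proof.
move=> yy zz; apply: (preorder_join leP).
  by apply: (preorder_trans leP) yy _; apply/(preorder_sle leP)/sle_addr.
by apply: (preorder_trans leP) zz _; apply/(preorder_sle leP)/sle_addl.
Qed.

Lemma preorder_mul2 y y' z z' : le y y' -> le z z' -> le (y * z) (y' * z').
Proof.
move=> yy zz; apply: (preorder_trans leP) (preorder_mul leP z yy) _.
by rewrite ![y' * _]mulrC; apply: (preorder_mul leP).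
Qed.

Let eqv y z := le y z /\ le z y.

Fact eqv_refl y : eqv y y.
Proof. by split; apply: preorder_refl. Qed.

Fact eqv_sym y z : eqv y z -> eqv z y.
Proof. by case. Qed.

Fact eqv_trans y z w : eqv y z -> eqv z w -> eqv y w.
Proof.
move=> [yz zy] [zw wz].
by split; [apply: (preorder_trans leP) yz zw | apply: (preorder_trans leP) wz zy].
Qed.

Fact eqvD y y' z z' : eqv y y' -> eqv z z' -> eqv (y + z) (y' + z').
Proof. by move=> [? ?] [? ?]; split; apply: preorder_add. Qed.

Fact eqvM y y' z z' : eqv y y' -> eqv z z' -> eqv (y * z) (y' * z').
Proof. by move=> [? ?] [? ?]; split; apply: preorder_mul2. Qed.

Definition preorder_congruence : congruence R :=
  Congruence eqv_refl eqv_sym eqv_trans eqvD eqvM.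

Lemma toquot_preorder y z :
  toquot preorder_congruence y <=+ toquot preorder_congruence z <-> le y z.
Proof.
rewrite /sle -rmorphD; split=> [/toquotP [yzz _]|yz].
  by apply: (preorder_trans leP) yzz; apply/(preorder_sle leP)/sle_addr.
apply/toquotP; split; first exact: (preorder_join leP) yz (preorder_refl z).
exact/(preorder_sle leP)/sle_addl.
Qed.

Lemma preorder_congruence_prime :
  ~ le 1 0 -> (forall y z, le y z \/ le z y) ->
  prime_congruence preorder_congruence.
Proof.
move=> le10 tot; split.
- by exists 1, 0 => -[].
- move=> b c; have [[y ->] [z ->]] := (toquot_surj b, toquot_surj c).
  by have [yz|zy] := tot y z; [left | right]; apply/toquot_preorder.
- move=> a a0; split=> // b c; move: a0; have [[s ->] [[y ->] [z ->]]] :=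
    (toquot_surj a, (toquot_surj b, toquot_surj c)).
  move=> s0; rewrite -!rmorphM => /toquotP []; rewrite ![s * _]mulrC => yz zy.
  have {}s0 : s <> 0 by move=> E; apply: s0; rewrite E rmorph0.
  by apply/toquotP; split; apply: (preorder_cancel leP s0).
Qed.

End PreorderCongruence.

Section Adjunction.
Variable R : comPzSemiRingType.
Variable le : R -> R -> Prop.
Hypothesis leP : cancellative_preorder le.

(** In a semifield, the preorder generated by [le] and [u <= v] compares [y] with
the multiples of [z] by the powers of [u / v + 1]; this is that description with
denominators cleared. *)
Definition adjoin (u v y z : R) : Prop :=
  exists n, le (y * v ^+ n) (z * (u + v) ^+ n).

Hypothesis addRR : forall a : R, a + a = a.
Variables u v : R.

Lemma le_adjoin y z : le y z -> adjoin u v y z.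
Proof. by exists 0; rewrite !expr0 !mulr1. Qed.

Lemma adjoin_gen : adjoin u v u v.
Proof.
exists 1%N; rewrite !expr1 mulrC; apply: (preorder_sle leP).
by apply: sle_mull; apply: sle_addr.
Qed.

Lemma adjoin_preorder : cancellative_preorder (adjoin u v).
Proof.
split.
- by move=> y z yz; apply/le_adjoin/(preorder_sle leP).
- move=> z y w [n yz] [m zw]; exists (n + m)%N; rewrite !exprD mulrA.
  apply: (preorder_trans leP) (preorder_mul leP (v ^+ m) yz) _.
  rewrite mulrAC [in X in le _ X]mulrCA [in X in le _ X]mulrC.
  exact: (preorder_mul leP).
- move=> y z w [n yw] [m zw]; exists (n + m)%N; rewrite mulrDl.
  have vpow k : v ^+ k <=+ (u + v) ^+ k.
    by apply: sle_exp2r => //; apply: sle_addl.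
  apply: (preorder_join leP); rewrite !exprD.
    rewrite !mulrA; apply: (preorder_trans leP) (preorder_mul leP _ yw) _.
    by apply/(preorder_sle leP)/sle_mull.
  rewrite ![_ ^+ n * _]mulrC !mulrA.
  apply: (preorder_trans leP) (preorder_mul leP _ zw) _.
  by apply/(preorder_sle leP)/sle_mull.
- move=> w y z [n yz]; exists n.
  by rewrite ![_ * w * _]mulrAC; apply: (preorder_mul leP).
- move=> s y z s0 [n yz]; exists n; apply: (preorder_cancel leP s0).
  by rewrite (mulrAC y) (mulrAC z).
Qed.

End Adjunction.

Section TotalExtension.
Variable R : comPzSemiRingType.
Hypothesis addRR : forall a : R, a + a = a.
Hypothesis nonzero_mul : forall s t : R, s <> 0 -> t <> 0 -> s * t <> 0.
Hypothesis neq10 : 1 <> 0 :> R.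

(** If [u <= v] and [v <= u] both force [x <= 1], with exponents [n] and [m], then
[x * (u + v) ^+ (n + m) <= (u + v) ^+ (n + m)]: each monomial on the left
contains [v ^+ n] or [u ^+ m]. *)
Lemma adjoin_le1 (le : R -> R -> Prop) (u v x : R) :
  cancellative_preorder le -> u <> 0 ->
  adjoin le u v x 1 -> adjoin le v u x 1 -> le x 1.
Proof.
move=> leP u0 [n xv] [m]; rewrite [v + u]addrC !mul1r => xu.
rewrite mul1r in xv; set w := u + v in xv xu.
have w0 : w <> 0 by move=> E; apply/u0/sle_eq0; rewrite -E; apply: sle_addr.
have wX0 k : w ^+ k <> 0.
  by elim: k => [|k IH]; rewrite ?expr0 // exprS; apply: nonzero_mul.
have powle (z : R) k : z <=+ w -> le (z ^+ k) (w ^+ k).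
  by move=> zw; apply/(preorder_sle leP)/sle_exp2r.
have uw : u <=+ w by apply: sle_addr.
have vw : v <=+ w by apply: sle_addl.
apply: (preorder_cancel leP (wX0 (n + m)%N)); rewrite mul1r.
have -> : x * w ^+ (n + m) = \sum_(i < (n + m).+1)
    x * (u ^+ (n + m - i) * v ^+ i *+ 'C(n + m, i)).
  by rewrite exprDn mulr_sumr.
apply: (big_ind (fun y => le y (w ^+ (n + m)))).
- exact/(preorder_sle leP)/sle0.
- by move=> y z; apply: (preorder_join leP).
move=> i _; have lei := ltn_ord i.
rewrite mulrn_idem ?bin_gt0 //.
have [ni|ni] := leqP n i.
  have -> : (w ^+ (n + m) = w ^+ (n + m - i) * (w ^+ (i - n) * w ^+ n)).
    by rewrite -!exprD subnK // subnK.
  rewrite -{2}(subnK ni) exprD mulrCA; apply: (preorder_mul2 leP).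
    exact: powle.
  by rewrite mulrCA; apply: (preorder_mul2 leP) => //; apply: powle.
have mi : (m <= n + m - i)%N by rewrite leq_subRL // leq_add2r ltnW.
have -> : (w ^+ (n + m) = w ^+ (n + m - i - m) * w ^+ m * w ^+ i).
  by rewrite -!exprD subnK // subnK.
rewrite -{1}(subnK mi) exprD mulrA; apply: (preorder_mul2 leP).
  by rewrite mulrCA; apply: (preorder_mul2 leP) => //; apply: powle.
exact: powle.
Qed.

(** If neither [u <= v] nor [v <= u] held in a maximal preorder, both could be
adjoined separately, and each would put [x] below 1. By [adjoin_le1], [x] would
already be below 1. *)
Lemma total_extension (le0 : R -> R -> Prop) (x : R) :
  cancellative_preorder le0 -> ~ le0 x 1 ->
  exists le, [/\ cancellative_preorder le, ~ le x 1,
    forall y z, le0 y z -> le y z & forall y z, le y z \/ le z y].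
Proof.
move=> le0P x1.
(* The union of the empty chain is empty, so it is [le0] together with the
   relation that has to be admissible. *)
pose ext (S : set (R * R)) y z := le0 y z \/ S (y, z).
pose good S := cancellative_preorder (ext S) /\ ~ ext S x 1.
have extS S T y z : (S `<=` T)%classic -> ext S y z -> ext T y z.
  by move=> ST [|/ST]; [left | right].
have good0 : good set0.
  have E : ext set0 = le0.
    by apply/funext => y; apply/funext => z; apply/propext; split=> [[]|]; last left.
  by rewrite /good E.
have [|M [[MP Mx] Mmax]] := @Zorn_bigcup _ good.
  move=> F Fgood Ftot; set U := (\bigcup_(X in F) X)%classic.
  have FU X : F X -> (X `<=` U)%classic by move=> FX p Xp; exists X.
  have common y z y' z' : ext U y z -> ext U y' z' ->
      exists S, [/\ good S, (S `<=` U)%classic, ext S y z & ext S y' z'].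
    move=> [yz|[S FS Syz]] [yz'|[T FT Tyz']].
    - by exists set0; split=> //; left.
    - by exists T; split; [apply: Fgood | apply: FU | left | right].
    - by exists S; split; [apply: Fgood | apply: FU | right | left].
    - have [ST|TS] := Ftot _ _ FS FT.
        by exists T; split; [apply: Fgood | apply: FU | right; apply: ST | right].
      by exists S; split; [apply: Fgood | apply: FU | right | right; apply: TS].
  split; last first.
    by move=> Ux; have [S [[_ Sx] _ Sx1 _]] := common _ _ _ _ Ux Ux.
  split.
  - by move=> y z yz; left; apply: (preorder_sle le0P).
  - move=> z y w yz zw; have [S [[SP _] SU {}yz {}zw]] := common _ _ _ _ yz zw.
    by apply: extS SU _; apply: (preorder_trans SP) yz zw.
  - move=> y z w yw zw; have [S [[SP _] SU {}yw {}zw]] := common _ _ _ _ yw zw.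
    by apply: extS SU _; apply: (preorder_join SP).
  - move=> w y z yz; have [S [[SP _] SU {}yz _]] := common _ _ _ _ yz yz.
    by apply: extS SU _; apply: (preorder_mul SP).
  - move=> s y z s0 yz; have [S [[SP _] SU {}yz _]] := common _ _ _ _ yz yz.
    by apply: extS SU _; apply: (preorder_cancel SP s0).
exists (ext M); split=> //; first by left.
have step u v : ~ ext M u v -> adjoin (ext M) u v x 1.
  move=> uv; apply: contrapT => nx.
  pose N : set (R * R) := [set p | adjoin (ext M) u v p.1 p.2]%classic.
  have extN : ext N = adjoin (ext M) u v.
    apply/funext => y; apply/funext => z; apply/propext; split=> [[yz|//]|].
      by apply: le_adjoin; left.
    by right.
  apply: (Mmax N); last by rewrite /good extN; split; [apply: adjoin_preorder |].
  split=> [[y z] Myz|]; first by apply: le_adjoin; right.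
  move=> NM; apply: uv; right; apply: NM.
  exact: adjoin_gen.
move=> u v; have [uv|uv] := pselect (ext M u v); [by left | right].
apply: contrapT => vu; apply/Mx/(adjoin_le1 MP (u := u) (v := v)).
- by move=> E; apply/uv/(preorder_sle MP); rewrite E; apply: sle0.
- exact: step.
- exact: step.
Qed.

End TotalExtension.

(** * The valuative closure *)

Lemma val_semiringE (R : comPzSemiRingType) (P : congruence R) (x : R) :
  val_semiring P x <-> toquot P x <=+ toquot P 1.
Proof.
rewrite /val_semiring /= /sle rmorph1.
have E : absv P x + 1 = totfrac (toquot P x + 1).
  by rewrite rmorphD rmorph1.
rewrite E -(rmorph1 (@totfrac (quot P))); split=> [/totfrac_inj //|-> //].
Qed.

Section Valuative.
Variables (R : comPzSemiRingType) (A : set R).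
Hypothesis addRR : forall a : R, a + a = a.
Hypothesis subA : subsemiring A.

Lemma J_sub_V : (J_closure A `<=` V_closure A)%classic.
Proof.
move=> x [n [a [n0 Aa xn]]] P [[_ tot canc] AP]; apply/val_semiringE.
have idem (c : quot P) : c + c = c.
  by have [y ->] := toquot_surj c; rewrite -rmorphD addRR.
rewrite rmorph1; set t := toquot P x; have [//|t1] := tot t 1.
have [t0|t0] := pselect (t = 0); first by rewrite t0; apply: sle0.
have [_ treg] := canc _ t0.
rewrite /sle; apply: (lregX (n := n.-1) treg); rewrite mulrDr mulr1 -exprSr prednK //.
apply: (@sle_trans _ (toquot P (\sum_(i < n) a i * x ^+ i))).
  by rewrite -rmorphXn /sle -rmorphD xn.
rewrite rmorph_sum; apply: sle_sum_join => i; rewrite rmorphM rmorphXn.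
apply: (@sle_trans _ (1 * t ^+ i)).
  by apply: sle_mulr; rewrite -(rmorph1 (toquot P)); apply/val_semiringE/AP.
by rewrite mul1r; apply: sle1_exp2l => //; rewrite -ltnS prednK.
Qed.

Hypothesis genR : cancellatively_generated R.
Hypothesis finA : forall x : R, finite_module A (down_module_gen A x).

(** The preorder [le0] is the one that compares [y] and [z] by a fraction
dominated by [A]; [x] is not below 1 for it precisely by
[dominated_J_integral]. *)
Lemma V_sub_J : (V_closure A `<=` J_closure A)%classic.
Proof.
move=> x Vx; apply: contrapT => nJ.
have neq10 : 1 <> 0 :> R.
  by move=> E; apply: nJ; apply: trivial_J_integral.
have nz := nonzero_mul addRR genR.
pose le0 y z := exists s a, [/\ s <> 0, A a & s * y <=+ a * (s * z)].
have le0A y z a : A a -> y <=+ a * z -> le0 y z.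
  by move=> Aa yz; exists 1, a; split=> //; rewrite !mul1r.
have le0P : cancellative_preorder le0.
  split.
  - by move=> y z yz; apply: (le0A _ _ 1); rewrite ?mul1r //; apply: subsemiring1.
  - move=> z y w [s [a [s0 Aa yz]]] [t [b [t0 Ab zw]]].
    exists (s * t), (a * b); split; [exact: nz | exact: subsemiringM |].
    have -> : s * t * y = t * (s * y) by rewrite mulrA (mulrC t).
    have -> : a * b * (s * t * w) = a * (s * (b * (t * w))).
      by rewrite -!mulrA (mulrCA b).
    apply: sle_trans (sle_mull t yz) _.
    by rewrite mulrCA (mulrCA t); do 2 apply: sle_mull.
  - move=> y z w [s [a [s0 Aa yw]]] [t [b [t0 Ab zw]]].
    exists (s * t), (a + b); split; [exact: nz | exact: subsemiringD |].
    rewrite mulrDr mulrDl; apply: sle_add => //.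
      by rewrite ![s * t * _]mulrAC mulrA; apply: sle_mulr.
    by rewrite -![s * t * _]mulrA [b * _]mulrCA; apply: sle_mull.
  - move=> w y z [s [a [s0 Aa yz]]]; exists s, a; split=> //.
    by rewrite !mulrA; apply: sle_mulr; rewrite -mulrA.
  - move=> r y z r0 [s [a [s0 Aa yz]]]; exists (s * r), a; split=> //.
      exact: nz.
    by rewrite -![s * r * _]mulrA ![r * _]mulrC.
have nx1 : ~ le0 x 1.
  move=> [s [a [s0 Aa]]]; rewrite mulr1 => sx.
  exact: nJ (dominated_J_integral addRR genR subA finA Aa s0 sx).
have [le [leP lex lele tot]] := total_extension addRR nz neq10 le0P nx1.
have prP : prime_congruence (preorder_congruence addRR leP).
  apply: preorder_congruence_prime tot => le10; apply: lex.
  apply: (preorder_trans leP) (preorder_sle leP (sle0 1)).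
  by rewrite -[x]mul1r -(mul0r x); apply: (preorder_mul leP).
apply/lex/(toquot_preorder addRR leP)/val_semiringE/Vx; split=> // a Aa.
apply/val_semiringE/toquot_preorder/lele/(le0A _ _ a Aa).
by rewrite mulr1; apply: sle_refl.
Qed.

End Valuative.

Theorem theorem1p4 (R : comPzSemiRingType) (A : set R)
    (addRR : forall a : R, a + a = a)
    (subA : subsemiring A)
    (genR : cancellatively_generated R)
    (canc_sqrt : cancellative_congruence (sqrtDelta R))
    (finA : forall x : R, finite_module A (down_module_gen A x)) :
  [/\ J_closure A = D_closure A,
      D_closure A = Q_closure A
    & Q_closure A = V_closure A].
Proof.
have JD := @J_sub_D R A addRR.
have DQ := D_sub_Q addRR subA.
have QJ := Q_sub_J addRR subA genR finA.
have JV := @J_sub_V R A addRR.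
have VJ := V_sub_J addRR subA genR finA.
split; apply/seteqP; split=> // x.
- by move=> /DQ /QJ.
- by move=> /QJ /JD.
- by move=> /QJ /JV.
- by move=> /VJ /JD /DQ.
Qed.
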